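(* Let $(X,r)$ be a solution with structure group $G(X,r)$, endowed with its brace addition $+$ and with the extension $R\colon G(X,r)\times G(X,r)\to G(X,r)\times G(X,r)$ of $r$, and let $k$ be a positive integer. Then the map $$\iota^{(k)}\colon X\to G(X,r),\qquad x\mapsto kx:=x+\cdots+x\ (k\text{ summands})$$ is injective, and its image is a sub-solution of $(G(X,r),R)$.
   Context: A solution $(X,r)$ is a non-empty finite set $X$, with $|X|>1$, together with an involutive map $r\colon X\times X\to X\times X$, $r(x,y)=(\sigma_x(y),\tau_y(x))$, satisfying $r_1r_2r_1=r_2r_1r_2$ on $X^3$, where $r_1=r\times \mathrm{Id}_X$ and $r_2=\mathrm{Id}_X\times r$, and such that all maps $\sigma_x$ and $\tau_x$ ($x\in X$) are bijections of $X$. The structure group is $G(X,r)=\langle X\mid xy=\sigma_x(y)\tau_y(x)\text{ for all }x,y\in X\rangle$. It is known that $X$ embeds in $G(X,r)$ and that $G(X,r)$ carries a second, commutative group operation $+$ satisfying $a(b+c)=ab-a+ac$ for all $a,b,c$ (so that it is a brace), with $x+y=x\,\sigma_x^{-1}(y)$ for $x,y\in X$, and such that $(G(X,r),+)$ is free abelian with basis $X$. The extension of $r$ to $G=G(X,r)$ is the map $R(a,b)=(\lambda_a(b),\lambda_a(b)^{-1}ab)$, where $\lambda_a(b)=-a+ab$; it is an involutive non-degenerate solution to the Yang--Baxter equation on $G$ (an infinite set) that restricts to $r$ on $X\times X$. A subset $Y\subseteq G$ is a sub-solution if $R(Y\times Y)=Y\times Y$ and the restriction of $R$ to $Y\times Y$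 is again an involutive non-degenerate solution to the Yang--Baxter equation on $Y$. *)

(* Defs.v *)
From HB Require Import structures.
From mathcomp Require Import all_boot all_order perm all_algebra.
From mathcomp Require Import zify boolp classical_sets functions.

Set Implicit Arguments.
Unset Strict Implicit.
Unset Printing Implicit Defensive.

Import GRing.Theory.

Local Open Scope classical_set_scope.
Local Open Scope quotient_scope.
Local Open Scope ring_scope.

Section SolutionOn.
Variables (T : Type) (r : T * T -> T * T).

Definition yb1 (t : T * T * T) : T * T * T :=
  let: (x, y, z) := t in let: (u, v) := r (x, y) in (u, v, z).

Definition yb2 (t : T * T * T) : T * T * T :=
  let: (x, y, z) := t in let: (u, v) := r (y, z) in (x, u, v).

(* With r (x, y) = (sigma_x y, tau_y x), the last two fields say that every
   sigma_x and every tau_x (x in A) is a bijection of A. *)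
Record solution_on (A : set T) : Prop := SolutionOn {
  sol_stable : set_fun (A `*` A) (A `*` A) r;
  sol_invol : {in A `*` A, forall p, r (r p) = p};
  sol_ybe : {in A `*` A `*` A,
    forall t, yb1 (yb2 (yb1 t)) = yb2 (yb1 (yb2 t))};
  sol_sigma_bij : forall x, A x -> set_bij A A (fun y => (r (x, y)).1);
  sol_tau_bij : forall x, A x -> set_bij A A (fun y => (r (y, x)).2) }.

Definition sub_solution (Y : set T) : Prop :=
  r @` (Y `*` Y) = Y `*` Y /\ solution_on Y.

End SolutionOn.

Record solution := Solution {
  carrier :> finType;
  smap : carrier * carrier -> carrier * carrier;
  carrier_gt1 : (1 < #|carrier|)%N;
  smapP : solution_on smap [set: carrier] }.

Section Sigma.
Variable S : solution.
Implicit Types x y z : S.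

Definition sig x y : S := (smap (x, y)).1.
Definition tau y x : S := (smap (x, y)).2.

Lemma smapE x y : smap (x, y) = (sig x y, tau y x).
Proof. by rewrite /sig /tau; case: smap. Qed.

Lemma sig_inj x : injective (sig x).
Proof.
have [_ + _] := sol_sigma_bij (smapP S) (I : [set: S] x).
by move=> inj y z; apply: inj; apply/mem_set.
Qed.

Definition sigma x : {perm S} := perm (@sig_inj x).

Lemma sigmaE x y : sigma x y = sig x y. Proof. exact: permE. Qed.

Lemma sig_tau x y : sig (sig x y) (tau y x) = x.
Proof.
have := sol_invol (smapP S) (mem_set (conj I I : ([set: S] `*` [set: S]) (x, y))).
by rewrite smapE smapE => -[].
Qed.

Lemma tau_sig x y : tau (tau y x) (sig x y) = y.
Proof.
have := sol_invol (smapP S) (mem_set (conj I I : ([set: S] `*` [set: S]) (x, y))).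
by rewrite smapE smapE => -[].
Qed.

Lemma sigmaM x y :
  (sigma y * sigma x)%g = (sigma (tau y x) * sigma (sig x y))%g.
Proof.
apply/permP => z; rewrite !permM !sigmaE.
have /(_ (x, y, z)) := sol_ybe (smapP S).
move=> /(_ (mem_set (conj (conj I I) I))).
by rewrite /yb1 /yb2 !smapE => -[].
Qed.

(* The bijection D(y) = sigma_y^-1(y), with inverse z |-> tau_z^-1(z). *)
Definition sdiag y : S := (sigma y)^-1%g y.

Lemma sdiag_inj : injective sdiag.
Proof.
have tauD y : tau (sdiag y) y = sdiag y.
  have sD : sig y (sdiag y) = y by rewrite -sigmaE permKV.
  by apply: (@sig_inj y); rewrite sD -{1}sD sig_tau.
have tau_inj y : injective (tau y).
  have [_ + _] := sol_tau_bij (smapP S) (I : [set: S] y).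
  by move=> inj z t; apply: inj; apply/mem_set.
by move=> y z e; apply: (tau_inj (sdiag y)); rewrite tauD {1 2}e tauD.
Qed.

Definition sdiagV : S -> S := invF sdiag_inj.

End Sigma.

Section Words.
Variable S : solution.

Definition word := seq (S + S).

(* The congruence presenting < X | x y = sigma_x(y) tau_y(x) > as a group. *)
Inductive wcong : word -> word -> Prop :=
| wcong_refl u : wcong u u
| wcong_sym u v : wcong u v -> wcong v u
| wcong_trans u v w : wcong u v -> wcong v w -> wcong u w
| wcong_cat u u' v v' : wcong u u' -> wcong v v' -> wcong (u ++ v) (u' ++ v')
| wcong_xV x : wcong [:: inl x; inr x] [::]
| wcong_Vx x : wcong [:: inr x; inl x] [::]
| wcong_rel x y :
    wcong [:: inl x; inl y] [:: inl (sig x y); inl (tau y x)].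

Definition wcongb : rel word := fun u v => `[< wcong u v >].

Fact wcongb_refl : reflexive wcongb.
Proof. by move=> u; apply/asboolP; constructor. Qed.
Fact wcongb_sym : symmetric wcongb.
Proof. by move=> u v; apply: asbool_equiv_eq; split; apply: wcong_sym. Qed.
Fact wcongb_trans : transitive wcongb.
Proof.
move=> v u w /asboolP uv /asboolP vw; apply/asboolP; exact: wcong_trans uv vw.
Qed.

Canonical wcong_equiv := EquivRel wcongb wcongb_refl wcongb_sym wcongb_trans.

Definition structure_group := {eq_quot wcong_equiv}.

HB.instance Definition _ := Choice.on structure_group.
HB.instance Definition _ := EqQuotient.on structure_group.

Notation G := structure_group.

Definition flip_letter (l : S + S) : S + S :=
  match l with inl x => inr x | inr x => inl x end.
Definition winv (w : word) : word := rev (map flip_letter w).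

Definition sg_one : G := \pi_G [::].
Definition sg_mul (a b : G) : G := \pi_G (repr a ++ repr b).
Definition sg_inv (a : G) : G := \pi_G (winv (repr a)).

Lemma piP (u v : word) : \pi_G u = \pi_G v <-> wcong u v.
Proof.
split=> [/eqmodP/asboolP//|uv]; exact/eqmodP/asboolP.
Qed.

Lemma sg_mulE u v : sg_mul (\pi_G u) (\pi_G v) = \pi_G (u ++ v).
Proof. by apply/piP/wcong_cat; apply/piP; rewrite reprK. Qed.

Lemma wcong_mulwV w : wcong (w ++ winv w) [::].
Proof.
elim: w => [|l w IH]; first exact: wcong_refl.
rewrite /winv /= rev_cons -/(winv w) -cats1 -cat1s.
apply: (@wcong_trans _ ([:: l] ++ [::] ++ [:: flip_letter l])).
  apply: wcong_cat; first exact: wcong_refl.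
  by rewrite catA; apply: wcong_cat => //; apply: wcong_refl.
by case: l => x; [exact: wcong_xV | exact: wcong_Vx].
Qed.

Lemma winvK : involutive winv.
Proof.
by move=> w; rewrite /winv map_rev revK -map_comp map_id_in // => -[].
Qed.

Fact sg_mulA : associative sg_mul.
Proof.
elim/quotW=> u; elim/quotW=> v; elim/quotW=> w.
by rewrite (sg_mulE v w) (sg_mulE u v) !sg_mulE catA.
Qed.
Fact sg_mul1g : left_id sg_one sg_mul.
Proof. by elim/quotW=> w; rewrite sg_mulE. Qed.
Fact sg_mulg1 : right_id sg_one sg_mul.
Proof. by elim/quotW=> w; rewrite sg_mulE cats0. Qed.
Fact sg_mulgV : right_inverse sg_one sg_inv sg_mul.
Proof.
move=> a; rewrite /sg_inv -[X in sg_mul X _]reprK.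
by rewrite sg_mulE; apply/piP/wcong_mulwV.
Qed.
Fact sg_mulVg : left_inverse sg_one sg_inv sg_mul.
Proof.
move=> a; rewrite /sg_inv -[X in sg_mul _ X]reprK sg_mulE; apply/piP.
by rewrite -{2}[repr a]winvK; apply: wcong_mulwV.
Qed.

HB.instance Definition _ :=
  isGroup.Build structure_group sg_mulA sg_mul1g sg_mulg1 sg_mulVg sg_mulgV.

Definition gen (x : S) : G := \pi_G [:: inl x].

Lemma piV (x : S) : \pi_G [:: inr x] = (gen x)^-1%g.
Proof.
apply: (@mulgI _ (gen x)); rewrite mulgV [LHS]sg_mulE.
by apply/piP; exact: wcong_xV.
Qed.

End Words.

Section Degree.
Variable S : solution.
Notation G := (structure_group S).
Notation ZS := {ffun S -> int}.
Implicit Types (x y : S) (a b c g : G) (u v : ZS) (w : word S).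

Definition delta x : ZS := [ffun z => (z == x)%:R].
Definition pact (p : {perm S}) (v : ZS) : ZS := [ffun z => v (p^-1%g z)].

(* State after reading the word of g: the degree of g in Z^X and the
   permutation sigma_g, so that deg (g x) = deg g + delta (sigma_g x). *)
Definition step (s : ZS * {perm S}) (l : S + S) : ZS * {perm S} :=
  match l with
  | inl x => (s.1 + delta (s.2 x), (sigma x * s.2)%g)
  | inr x => let p := ((sigma x)^-1 * s.2)%g in (s.1 - delta (p x), p)
  end.

Definition run s w := foldl step s w.

Lemma run_cat s w1 w2 : run s (w1 ++ w2) = run (run s w1) w2.
Proof. exact: foldl_cat. Qed.

Lemma run_cong w w' : wcong w w' -> forall s, run s w = run s w'.
Proof.
elim=> {w w'} [//|//|||x|x|x y].
- by move=> w1 w2 w3 _ IH1 _ IH2 s; rewrite IH1 IH2.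
- by move=> w1 w1' w2 w2' _ IH1 _ IH2 s; rewrite !run_cat IH1 IH2.
- by move=> [v p]; rewrite /run /= mulgA mulVg mul1g addrK.
- by move=> [v p]; rewrite /run /= mulgA mulgV mul1g subrK.
- move=> [v p]; rewrite /run /= !mulgA sigmaM; congr pair.
  by rewrite !permM !sigmaE sig_tau -!addrA [delta (p x) + _]addrC.
Qed.

Definition state g := run (0, 1%g) (repr g).
Definition deg g := (state g).1.
Definition lperm g := (state g).2.

Lemma statePi w : state (\pi_G w) = run (0, 1%g) w.
Proof. by rewrite /state; apply: run_cong; apply/piP; rewrite reprK. Qed.

Lemma pactD p u v : pact p (u + v) = pact p u + pact p v.
Proof. by apply/ffunP => z; rewrite !ffunE. Qed.
Lemma pactN p v : pact p (- v) = - pact p v.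
Proof. by apply/ffunP => z; rewrite !ffunE. Qed.
Lemma pact0 p : pact p 0 = 0.
Proof. by apply/ffunP => z; rewrite !ffunE. Qed.
Lemma pact_delta p x : pact p (delta x) = delta (p x).
Proof.
by apply/ffunP => z; rewrite !ffunE -(inj_eq (@perm_inj _ p)) permKV.
Qed.

Lemma run_act v p w :
  run (v, p) w = (v + pact p (run (0, 1%g) w).1, ((run (0, 1%g) w).2 * p)%g).
Proof.
elim/last_ind: w => [|w l IH]; first by rewrite /run /= pact0 addr0 mul1g.
rewrite -cats1 !run_cat IH.
case: (run _ w) => u q; case: l => x /=.
- by rewrite pactD pact_delta permM addrA mulgA.
- by rewrite pactD pactN pact_delta !permM addrA mulgA.
Qed.

Lemma state1 : state 1%g = (0, 1%g). Proof. exact: statePi. Qed.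

Lemma stateM a b :
  state (a * b)%g = (deg a + pact (lperm a) (deg b), (lperm b * lperm a)%g).
Proof.
rewrite -[a in LHS]reprK -[b in LHS]reprK [(_ * _)%g]sg_mulE statePi.
rewrite run_cat /deg /lperm.
by rewrite -/(state a); case: (state a) => v p; rewrite run_act.
Qed.

Lemma deg1 : deg 1%g = 0. Proof. by rewrite /deg state1. Qed.
Lemma degM a b : deg (a * b)%g = deg a + pact (lperm a) (deg b).
Proof. by rewrite {1}/deg stateM. Qed.
Lemma lperm1 : lperm 1%g = 1%g. Proof. by rewrite /lperm state1. Qed.
Lemma lpermM a b : lperm (a * b)%g = (lperm b * lperm a)%g.
Proof. by rewrite {1}/lperm stateM. Qed.
Lemma lpermV a : lperm a^-1%g = (lperm a)^-1%g.
Proof.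
apply: (@mulIg _ (lperm a)); rewrite mulVg.
by rewrite -lpermM mulgV lperm1.
Qed.
Lemma deg_gen x : deg (gen x) = delta x.
Proof. by rewrite /deg statePi /run /= perm1 add0r. Qed.
Lemma lperm_gen x : lperm (gen x) = sigma x.
Proof. by rewrite /lperm statePi /run /= mulg1. Qed.

Lemma gen_rel x y : (gen x * gen y = gen (sig x y) * gen (tau y x))%g.
Proof.
by rewrite ![LHS]sg_mulE ![RHS]sg_mulE; apply/piP; exact: wcong_rel.
Qed.

(* Translation of G by a basis vector: deg (addx x g) = deg g + delta x. *)
Definition addx x g : G := (g * gen ((lperm g)^-1%g x))%g.
Definition subx x g : G := (g * (gen (sdiagV ((lperm g)^-1%g x)))^-1)%g.

Lemma deg_addx x g : deg (addx x g) = deg g + delta x.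
Proof. by rewrite degM deg_gen pact_delta permKV. Qed.

Lemma addxK x : cancel (addx x) (subx x).
Proof.
move=> g; rewrite /subx {2}/addx lpermM lperm_gen invgM permM.
by rewrite -/(sdiag _) /sdiagV invF_f /addx mulgK.
Qed.

Lemma subxK x : cancel (subx x) (addx x).
Proof.
move=> g; rewrite /addx {2}/subx lpermM lpermV lperm_gen invgM invgK permM.
set y := sdiagV _; have -> : (lperm g)^-1%g x = (sigma y)^-1%g y.
  by rewrite -/(sdiag y) f_invF.
by rewrite permKV /subx -/y mulgVK.
Qed.

Lemma deg_subx x g : deg (subx x g) = deg g - delta x.
Proof. by rewrite -{2}[g](subxK x) deg_addx addrK. Qed.

Lemma addxC x y g : addx x (addx y g) = addx y (addx x g).
Proof.
rewrite /addx !lpermM !lperm_gen !invgM !permM -!mulgA; congr (_ * _)%g.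
set a := _ y; set b := _ x.
have E : sig a ((sigma a)^-1%g b) = b by rewrite -sigmaE permKV.
rewrite gen_rel E; congr (_ * gen _)%g.
by apply: (@perm_inj _ (sigma b)); rewrite permKV sigmaE -{1}E sig_tau.
Qed.

Definition shift x (n : int) g : G :=
  match n with
  | Posz m => iter m (addx x) g
  | Negz m => iter m.+1 (subx x) g
  end.

Lemma shiftS x n g : shift x (n + 1) g = addx x (shift x n g).
Proof.
case: n => [n|[|n]]; first by rewrite -PoszD addn1.
  by rewrite /= subxK.
by rewrite (_ : Negz n.+1 + 1 = Negz n) /= ?subxK // !NegzE; lia.
Qed.

Lemma shiftC x y n g : shift x n (addx y g) = addx y (shift x n g).
Proof.
have C z h : subx x (addx z h) = addx z (subx x h).
  by apply: (can_inj (addxK x)); rewrite subxK addxC subxK.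
have I (f : G -> G) m : (forall h, f (addx y h) = addx y (f h)) ->
    iter m f (addx y g) = addx y (iter m f g).
  by move=> fC; elim: m => //= m ->; rewrite fC.
by case: n => n; apply: I => h; [exact: addxC | exact: C].
Qed.

Definition translate v g : G := foldr (fun x => shift x (v x)) g (enum S).

Lemma translateS v x g : translate (v + delta x) g = addx x (translate v g).
Proof.
rewrite /translate; have := mem_enum S x; rewrite inE.
elim: (enum S) (enum_uniq S) => //= y s IH /andP[ys us].
rewrite inE; have [-> _|xy /= xs] := eqVneq x y.
  rewrite !ffunE eqxx shiftS; congr (addx _ (shift _ _ _)).
  elim: s ys {us IH} => //= z s IH; rewrite inE negb_or eq_sym.
  by move=> /andP[zx zs]; rewrite IH // !ffunE (negPf zx) addr0.
by rewrite !ffunE eq_sym (negPf xy) addr0 IH // shiftC.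
Qed.

Lemma translate0 g : translate 0 g = g.
Proof. by rewrite /translate; elim: (enum S) => //= x s ->; rewrite ffunE. Qed.

Lemma degK : cancel deg (translate^~ 1%g).
Proof.
move=> g; rewrite -[g]reprK; elim/last_ind: (repr g) => [|w l].
  by rewrite -/(1%g : G) deg1 translate0.
rewrite -cats1 -sg_mulE -[sg_mul _ _]/(\pi_G w * \pi_G [:: l])%g.
move: (\pi_G w) => {w g} h IH.
case: l => x.
  rewrite -/(gen x).
  by rewrite degM deg_gen pact_delta translateS IH /addx permK.
rewrite piV.
set k := (h * _)%g; have {1 2}-> : k = subx (lperm k x) h.
  apply: (can_inj (addxK (lperm k x))); rewrite subxK /addx permK.
  by rewrite /k mulgVK.
apply: (can_inj (addxK (lperm k x))).
by rewrite -translateS deg_subx subrK IH subxK.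
Qed.

Lemma translateK : cancel (translate^~ 1%g) deg.
Proof.
move=> v; have dsh x n g : deg (shift x n g) = deg g + delta x *~ n.
  case: n => n /=.
    by elim: n => [|n IH] /=; rewrite ?addr0 // deg_addx IH -addrA -mulrSr.
  rewrite deg_subx; elim: n => [|n IH] //=.
  by rewrite deg_subx IH -addrA -opprD -mulrSr.
rewrite /translate.
have -> s : deg (foldr (fun x => shift x (v x)) 1%g s) =
            \sum_(x <- s) delta x *~ v x.
  by elim: s => [|x s IH]; rewrite ?big_nil ?deg1 // big_cons /= dsh IH addrC.
rewrite big_enum; apply/ffunP => z; rewrite sum_ffunE (bigD1 z) //=.
rewrite big1 => [|x xz]; first by rewrite ffunMzE ffunE eqxx addr0 intz.
by rewrite ffunMzE ffunE eq_sym (negPf xz) mul0rz.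
Qed.

End Degree.

Section Brace.
Variable S : solution.
Notation G := (structure_group S).
Implicit Types (x y : S) (a b c g : G).

(* The brace addition, transported from Z^X along the bijective 1-cocycle deg;
   [translate^~ 1] is the inverse of deg.  See [brace_eq], [gen_addE],
   [gen_basis] and [add_unique] below for its characterization. *)
Definition sg_add a b : G := translate (deg a + deg b) 1%g.
Definition sg_opp a : G := translate (- deg a) 1%g.

Fact sg_addA : associative sg_add.
Proof. by move=> a b c; rewrite /sg_add !translateK addrA. Qed.
Fact sg_addC : commutative sg_add.
Proof. by move=> a b; rewrite /sg_add addrC. Qed.
Fact sg_add0 : left_id (1%g : G) sg_add.
Proof. by move=> a; rewrite /sg_add deg1 add0r degK. Qed.
Fact sg_addN : left_inverse (1%g : G) sg_opp sg_add.
Proof. by move=> a; rewrite /sg_add translateK addNr translate0. Qed.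

HB.instance Definition _ :=
  GRing.isZmodule.Build (structure_group S) sg_addA sg_addC sg_add0 sg_addN.

Lemma degD : {morph @deg S : a b / a + b}.
Proof. by move=> a b; rewrite [LHS]translateK. Qed.
Lemma deg0 : deg (0 : G) = 0. Proof. exact: deg1. Qed.
Lemma degN : {morph @deg S : a / - a}.
Proof. by move=> a; rewrite [LHS]translateK. Qed.
Lemma degMn a n : deg (a *+ n) = deg a *+ n.
Proof. by elim: n => [|n IH]; rewrite ?deg0 // !mulrS degD IH. Qed.
Lemma deg_inj : injective (@deg S). Proof. exact: can_inj (@degK S). Qed.

Lemma brace_eq a b c : (a * (b + c)%R)%g = (a * b)%g - a + (a * c)%g.
Proof.
apply: deg_inj; rewrite !(degD, degN, degM) pactD.
by rewrite !addrA subrK.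
Qed.

Lemma gen_addE x y : gen x + gen y = (gen x * gen ((sigma x)^-1 y))%g.
Proof.
by apply: deg_inj; rewrite degD degM !deg_gen lperm_gen pact_delta permKV.
Qed.

Lemma gen_inj : injective (@gen S).
Proof.
move=> x y /(congr1 (@deg S)); rewrite !deg_gen => /ffunP/(_ x).
by rewrite !ffunE eqxx; case: eqVneq.
Qed.

(* (G, +) is free abelian with basis X. *)
Lemma gen_basis g : exists! v : {ffun S -> int}, g = \sum_x gen x *~ v x.
Proof.
have degS (v : {ffun S -> int}) : deg (\sum_x gen x *~ v x) = v.
  rewrite (big_morph _ degD deg0); apply/ffunP => z.
  have degZ x n : deg (gen x *~ n) = delta x *~ n.
    by case: n => n; rewrite -?pmulrn ?NegzE ?mulrNz ?degN degMn deg_gen.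
  rewrite sum_ffunE (bigD1 z) //= big1 => [|x xz]; rewrite degZ ffunMzE ffunE.
    by rewrite eqxx addr0 intz.
  by rewrite eq_sym (negPf xz) mul0rz.
exists (deg g); split=> [|v ->]; last exact: degS.
by apply: deg_inj; rewrite degS.
Qed.

(* [brace_eq] and [gen_addE] determine the addition. *)
Lemma add_unique (plus : G -> G -> G) (zero : G) (opp : G -> G) :
  associative plus -> commutative plus -> left_id zero plus ->
  left_inverse zero opp plus ->
  (forall a b c, (a * plus b c = plus (plus (a * b) (opp a)) (a * c))%g) ->
  (forall x y, plus (gen x) (gen y) = (gen x * gen ((sigma x)^-1 y))%g) ->
  forall a b, plus a b = a + b.
Proof.
move=> pA pC p0 pN pbr pgen.
have pK a b : plus (opp a) (plus a b) = b by rewrite pA pN p0.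
have pNK a b : plus a (plus (opp a) b) = b by rewrite pA (pC a) pN p0.
pose l a b := plus (opp a) (a * b)%g.
have mulE a b : (a * b)%g = plus a (l a b) by rewrite pNK.
have lD a b c : l a (plus b c) = plus (l a b) (l a c).
  by rewrite /l pbr -!pA; congr plus; rewrite (pC (opp a) (a * b)%g) -!pA.
have zero1 : zero = 1%g.
  have := lD 1%g zero zero; rewrite p0 => /(congr1 (plus (opp (l 1%g zero)))).
  rewrite pK pN /l mul1g => /(congr1 (plus 1%g)).
  by rewrite pNK pC p0.
have lM a b c : l (a * b)%g c = l a (l b c).
  have E : plus (a * b)%g (l a (l b c)) = (a * b * c)%g.
    by rewrite -mulgA (mulE a b) -pA -lD -mulE -mulE.
  by rewrite {1}/l -E pK.
have l1 b : l 1%g b = b by rewrite /l mul1g -{1}[b]p0 zero1 pK.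
have lgen a x : l a (gen x) = gen (lperm a x).
  rewrite -[a]reprK; elim/last_ind: (repr a) x => [|w s IH] x.
    by rewrite -/(1%g : G) l1 lperm1 perm1.
  rewrite -cats1 -sg_mulE -[sg_mul _ _]/(\pi_G w * \pi_G [:: s])%g.
  rewrite lM lpermM permM -IH; congr (l _ _).
  have lg y z : l (gen y) (gen z) = gen (sigma y z).
    by rewrite /l -{1}[z](permK (sigma y)) -pgen pK.
  case: s => y; first by rewrite -/(gen y) lg lperm_gen.
  rewrite piV lpermV lperm_gen -{1}[x](permKV (sigma y)) -lg -lM mulVg.
  exact: l1.
have padd a x : plus a (gen x) = a + gen x.
  rewrite -{1}[x](permKV (lperm a)) -lgen -mulE; apply: deg_inj.
  by rewrite degM degD !deg_gen pact_delta permKV.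
have mgen g x : (g * gen x)%g = g + gen (lperm g x) by rewrite mulE lgen padd.
move=> a b; rewrite -[b]reprK; elim/last_ind: (repr b) => [|w s IH].
  transitivity a; last by symmetry; exact: addr0.
  by rewrite -[RHS]p0 pC zero1.
rewrite -cats1 -sg_mulE -[sg_mul _ _]/(\pi_G w * \pi_G [:: s])%g.
case: s => x; first by rewrite -/(gen x) mgen -padd pA IH !padd addrA.
rewrite piV; set k := (_ * _)%g.
have kx : \pi_G w = k + gen (lperm k x) by rewrite -mgen mulgVK.
apply: (@addIr _ (gen (lperm k x))).
by rewrite -padd -pA padd -kx IH kx addrA.
Qed.

Definition lam a b : G := - a + (a * b)%g.

Definition Rext (p : G * G) : G * G :=
  let: (a, b) := p in (lam a b, ((lam a b)^-1 * a * b)%g).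

Definition iotak (k : nat) (x : S) : G := gen x *+ k.

End Brace.

(* Main.v *)
Require Import Defs.
From mathcomp Require Import all_boot all_order perm all_algebra.
From mathcomp Require Import boolp classical_sets functions.

(** The first component of [Rext (a, b)] is [lam a b], and [a |-> lam a] is an
    action of the multiplicative group of the brace on its additive group
    ([lamM], [lamD]).  The degree shows that [lam a] permutes the generators,
    via [lperm a]; being additive it also permutes their multiples [k x]
    ([lam_iotak]).  The second component, written [rho b a] below, is
    determined by the relation [lam a b * rho b a = a * b], which gives
    [lam (lam a b) (rho b a) = a].  Hence [Rext] is involutive, and
    [rho b a = lam (lam a b)^-1 a] is again a multiple [k z] when [a] is one
    ([rho_iotak]).  So the image of [iotak k] is stable under [Rext].

    The Yang-Baxter equation holds on the whole group: both sides preserve the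
    product of a triple, so it is enough to compare outer components, and these
    agree since [lam] is a left action and [rho] is a right action ([rhoM]).
    Both actions are by injective maps, and on the finite image an injective
    self-map is bijective ([set_bij_range_inj]), which is non-degeneracy. *)

Local Open Scope classical_set_scope.

Import GRing.Theory Num.Theory.
Local Open Scope ring_scope.

(** [f] lifts along [i] to an injective self-map of a finite type. *)
Lemma set_bij_range_inj (X : finType) (T : Type) (i : X -> T) (f : T -> T) :
  injective f -> set_fun (range i) (range i) f -> injective i ->
  set_bij (range i) (range i) f.
Proof.
move=> f_inj f_fun i_inj; split=> //; first by move=> s t _ _ /f_inj.
have lift_f x : {y | f (i x) = i y}.
  by apply: cid; have [y _ <-] := f_fun _ (imageT i x); exists y.
pose g x := sval (lift_f x).
have gP x : f (i x) = i (g x) by rewrite /g; case: (lift_f x).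
have g_inj : injective g.
  by move=> x y e; apply/i_inj/f_inj; rewrite !gP e.
move=> _ [y _ <-]; exists (i (invF g_inj y)); first exact: imageT.
by rewrite gP f_invF.
Qed.

Section ExtendedSolution.
Variable S : solution.
Notation G := (structure_group S).
Implicit Types (x y : S) (a b c : G).

Lemma mulg_lam a b : (a * b)%g = a + lam a b.
Proof. by rewrite /lam addrA addrN add0r. Qed.

Lemma lamD a b c : lam a (b + c) = lam a b + lam a c.
Proof. by rewrite /lam brace_eq -!addrA. Qed.

(** Comparing [a * (b * c) = a * (b + lam b c)] with [(a * b) * c]. *)
Lemma lamM a b c : lam (a * b)%g c = lam a (lam b c).
Proof.
apply: (@addrI _ (a * b)%g); rewrite -mulg_lam -mulgA (mulg_lam b c).
by rewrite brace_eq -addrA.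
Qed.

Lemma lam1 b : lam 1%g b = b.
Proof. by rewrite -[RHS]mul1g mulg_lam [RHS]add0r. Qed.

Lemma lam_one a : lam a 1%g = 1%g.
Proof. by rewrite /lam mulg1 addNr. Qed.

Lemma lamK a : cancel (lam a) (lam a^-1%g).
Proof. by move=> b; rewrite -lamM mulVg lam1. Qed.

Definition rho b a : G := ((lam a b)^-1 * a * b)%g.

Lemma RextE a b : Rext (a, b) = (lam a b, rho b a).
Proof. by []. Qed.

Lemma lam_mul_rho a b : (lam a b * rho b a)%g = (a * b)%g.
Proof. by rewrite /rho -mulgA mulVKg. Qed.

(** Additively, [lam a b + lam (lam a b) (rho b a)] is the product
    [a * b = a + lam a b], and the addition is commutative. *)
Lemma lam_lam_rho a b : lam (lam a b) (rho b a) = a.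
Proof.
apply: (@addrI _ (lam a b)).
by rewrite -mulg_lam lam_mul_rho mulg_lam addrC.
Qed.

Lemma rho_lam a b : rho b a = lam (lam a b)^-1%g a.
Proof. by rewrite -{3}[a](lam_lam_rho a b) lamK. Qed.

Lemma rho_lam_rho a b : rho (rho b a) (lam a b) = b.
Proof. by rewrite {1}/rho lam_lam_rho -mulgA lam_mul_rho mulKg. Qed.

Lemma Rext_invol : involutive (@Rext S).
Proof. by move=> [a b]; rewrite !RextE lam_lam_rho rho_lam_rho. Qed.

(** [lam a] is a 1-cocycle twisted by [rho]: this makes [G] a matched pair
    with itself, so that [rho] is a right action. *)
Lemma lam_mul a b c : lam a (b * c)%g = (lam a b * lam (rho b a) c)%g.
Proof. by rewrite !mulg_lam lamD -!lamM lam_mul_rho. Qed.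

Lemma rhoM a b c : rho (b * c)%g a = rho c (rho b a).
Proof.
apply: (mulgI (lam a (b * c)%g)).
by rewrite lam_mul_rho lam_mul -[RHS]mulgA lam_mul_rho [RHS]mulgA lam_mul_rho mulgA.
Qed.

Lemma rho1 a : rho 1%g a = a.
Proof. by rewrite /rho lam_one invg1 mul1g mulg1. Qed.

Lemma rho_inj b : injective (rho b).
Proof. by apply: (can_inj (g := rho b^-1%g)) => a; rewrite -rhoM mulgV rho1. Qed.

Lemma Rext_ybe (t : G * G * G) :
  yb1 (@Rext S) (yb2 (@Rext S) (yb1 (@Rext S) t)) =
  yb2 (@Rext S) (yb1 (@Rext S) (yb2 (@Rext S) t)).
Proof.
case: t => [[a b] c]; rewrite /yb1 /yb2 !RextE.
have E1 : lam (lam a b) (lam (rho b a) c) = lam a (lam b c).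
  by rewrite -!lamM lam_mul_rho.
have E3 : rho (rho c b) (rho (lam b c) a) = rho c (rho b a).
  by rewrite -!rhoM lam_mul_rho.
rewrite E1 E3; congr (_, _, _).
(* The middle components: cancel the outer ones in the product [a * b * c]. *)
apply: (mulgI (lam a (lam b c))); apply: (mulIg (rho c (rho b a))).
rewrite -{1}E1 lam_mul_rho -mulgA lam_mul_rho mulgA lam_mul_rho.
by rewrite -E3 -[RHS]mulgA lam_mul_rho [RHS]mulgA lam_mul_rho -[RHS]mulgA lam_mul_rho mulgA.
Qed.

Lemma lam_gen a x : lam a (gen x) = gen (lperm a x).
Proof.
apply: deg_inj.
by rewrite /lam degD degN degM !deg_gen pact_delta addrA addNr add0r.
Qed.

Lemma lam_iotak k a x : lam a (iotak k x) = iotak k (lperm a x).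
Proof.
rewrite /iotak; elim: k => [|k IH]; first exact: lam_one.
by rewrite !mulrS lamD IH lam_gen.
Qed.

Lemma rho_iotak k b x :
  rho b (iotak k x) = iotak k (lperm (lam (iotak k x) b)^-1%g x).
Proof. by rewrite rho_lam lam_iotak. Qed.

(** The degree of [k x] is [k] times a basis vector of [Z^X]. *)
Lemma iotak_inj k : (0 < k)%N -> injective (@iotak S k).
Proof.
move=> k0 x y /(congr1 (@deg S)); rewrite !degMn !deg_gen => /ffunP/(_ x).
rewrite !ffunMnE !ffunE eqxx; case: eqVneq => // _ /eqP.
by rewrite mul0rn pnatr_eq0 -leqn0 leqNgt k0.
Qed.

Lemma Rext_range_iotak k :
  set_fun (range (@iotak S k) `*` range (@iotak S k))
          (range (@iotak S k) `*` range (@iotak S k)) (@Rext S).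
Proof.
move=> [a b] [[x _ /= <-] [y _ /= <-]]; split; eexists=> //; symmetry.
  exact: lam_iotak.
exact: rho_iotak.
Qed.

End ExtendedSolution.

Theorem theorem1 (S : solution) (k : nat) (hk : (0 < k)%N) :
  injective (@iotak S k) /\ sub_solution (@Rext S) (range (@iotak S k)).
Proof.
have stable := @Rext_range_iotak S k.
have i_inj := @iotak_inj S k hk.
split=> //; split.
  apply/seteqP; split=> [_ [p Yp <-]|p Yp]; first exact: stable.
  by exists (Rext p); [exact: stable | exact: Rext_invol].
split=> //.
- by move=> p _; apply: Rext_invol.
- by move=> t _; apply: Rext_ybe.
- move=> a Ya; apply: set_bij_range_inj => //; first exact: can_inj (@lamK S a).
  by move=> b Yb; case: (stable (a, b)).
- move=> b Yb; apply: set_bij_range_inj => //; first exact: (@rho_inj S b).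
  by move=> a Ya; case: (stable (a, b)).
Qed.
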